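(* Let $n\ge 2$. For any integer $k$ with $2\le k\le n$ and any $\lambda=(\lambda_1,\dots,\lambda_n)\in\mathbb{R}^n$ with all $\lambda_i>0$, $$\frac{1}{k(k-1)}\sigma_1(\lambda)-\frac{k\,\sigma_k(\lambda)}{(k-1)\,\sigma_{k-1}(\lambda)}+\frac{(k+1)\,\sigma_{k+1}(\lambda)}{k\,\sigma_k(\lambda)}\ge 0 .$$ Equality occurs if and only if $\lambda_1=\lambda_2=\cdots=\lambda_n$.
   Context: $\sigma_m(\lambda)=\sum_{1\le i_1<\cdots<i_m\le n}\lambda_{i_1}\cdots\lambda_{i_m}$ is the $m$-th elementary symmetric function of $\lambda\in\mathbb{R}^n$, with $\sigma_0=1$ and $\sigma_m=0$ for $m>n$. *)

(* Defs.v *)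
From mathcomp Require Import all_boot all_order all_algebra.
From mathcomp Require Import mpoly.

Set Implicit Arguments.
Unset Strict Implicit.
Unset Printing Implicit Defensive.

Import GRing.Theory.

Local Open Scope ring_scope.

Definition sigma (R : comNzRingType) (n m : nat) (lam : 'I_n -> R) : R :=
  (mesym n R m).@[lam].

(* An m-subset A of the index set is an increasing sequence
   i_1 < ... < i_m of indices. *)
Lemma sigmaE (R : comNzRingType) (n m : nat) (lam : 'I_n -> R) :
  sigma m lam = \sum_(A : {set 'I_n} | #|A| == m) \prod_(i in A) lam i.
Proof.
rewrite /sigma /mesym raddf_sum; apply: eq_bigr => A _ /=.
by rewrite rmorph_prod; apply: eq_bigr => i _ /=; rewrite mevalXU.
Qed.

Lemma sigma0 (R : comNzRingType) (n : nat) (lam : 'I_n -> R) :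
  sigma 0 lam = 1.
Proof. by rewrite /sigma mesym0E rmorph1. Qed.

Lemma sigma_gt (R : comNzRingType) (n m : nat) (lam : 'I_n -> R) :
  (n < m)%N -> sigma m lam = 0.
Proof. by move=> ltnm; rewrite /sigma mesym_geqnE // rmorph0. Qed.

(* Main.v *)
Require Import Defs.
From mathcomp Require Import all_boot all_order all_algebra.
From mathcomp Require Import reals.
From mathcomp Require Import ring.
From mathcomp.real_closed Require Import complex.

Set Implicit Arguments.
Unset Strict Implicit.
Unset Printing Implicit Defensive.

Import Order.TTheory GRing.Theory Num.Theory.

Local Open Scope ring_scope.

(** The elementary symmetric functions of [lam] are the coefficients of
    [f = \prod_i (1 + lam i *: 'X)].  Put
    [r j = j.+1%:R * sigma j.+1 lam / sigma j lam].  Up to the factor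
    [k * (k - 1)], the expression [E] of the theorem is
    [r 0 - k r (k - 1) + (k - 1) r k], and it is nonnegative because the
    sequence [r] is convex: the consecutive increments of this expression as
    [k] grows are nonnegative multiples of second differences of [r], and at
    [k = 2] it is the second difference [r 0 - 2 r 1 + r 2] itself
    ([coef_ratio_gap_ge]).

    The first second difference is explicit.  With the power sums [P1], [P2],
    [P3] of [lam], Newton's identities turn
    [sigma_1 ^ 2 sigma_2 - 4 sigma_2 ^ 2 + 3 sigma_1 sigma_3] into
    [P1 P3 - P2 ^ 2], which is nonnegative by Cauchy-Schwarz and vanishes
    only when all the [lam i] agree ([coef_ratio_convex0_sum]).

    The other second differences reduce to the first by differentiation:
    the ratio sequence of [f^`()] is that of [f] shifted by one
    ([coef_ratio_deriv]), and [f^`()] is again a constant times a product of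
    factors [1 + x *: 'X] with [x > 0] ([deriv_esym_poly_splits]).  The latter
    is Gauss-Lucas in its simplest form: a complex root [z] of [f^`()] that is
    not a root of [f] satisfies [\sum_i lam i / (1 + lam i * z) = 0], and the
    imaginary part of that sum is [- Im z] times a positive number, so [z] is
    real, and it is negative because [f^`()] has nonnegative coefficients.

    Since [E = 0] squeezes the second difference at [k = 2] to [0], equality
    forces the [lam i] to be equal.  Conversely, for constant [lam] the
    sequence [r j = (n - j) x] is affine, so that [E] vanishes. *)

(** * The generating polynomial and Newton's identities *)

Section EsymPoly.
Variable A : comNzRingType.
Implicit Types (x : A) (s : seq A).

Definition esym_poly s : {poly A} := \prod_(x <- s) (1 + x *: 'X).

Lemma esym_poly_cons x s :
  esym_poly (x :: s) = esym_poly s + x *: ('X * esym_poly s).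
Proof. by rewrite /esym_poly big_cons mulrDl mul1r -scalerAl. Qed.

Lemma coef0_esym_poly s : (esym_poly s)`_0 = 1.
Proof.
elim: s => [|x s IHs]; first by rewrite /esym_poly big_nil coef1.
by rewrite esym_poly_cons coefD coefZ coefXM IHs /= mulr0 addr0.
Qed.

Lemma coefS_esym_poly x s j :
  (esym_poly (x :: s))`_j.+1 = (esym_poly s)`_j.+1 + x * (esym_poly s)`_j.
Proof. by rewrite esym_poly_cons coefD coefZ coefXM. Qed.

Lemma coefS_esym_poly_nil j : (esym_poly [::])`_j.+1 = 0.
Proof. by rewrite /esym_poly big_nil coef1. Qed.

Lemma newton1 s : \sum_(x <- s) x = (esym_poly s)`_1.
Proof.
elim: s => [|x s IHs]; first by rewrite big_nil coefS_esym_poly_nil.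
by rewrite coefS_esym_poly coef0_esym_poly -IHs big_cons mulr1 addrC.
Qed.

Lemma newton2 s :
  \sum_(x <- s) x ^+ 2 = (esym_poly s)`_1 ^+ 2 - 2%:R * (esym_poly s)`_2.
Proof.
elim: s => [|x s IHs]; first by rewrite big_nil !coefS_esym_poly_nil; ring.
by rewrite big_cons IHs !coefS_esym_poly coef0_esym_poly; ring.
Qed.

Lemma newton3 s :
  \sum_(x <- s) x ^+ 3 = (esym_poly s)`_1 ^+ 3
    - 3%:R * (esym_poly s)`_1 * (esym_poly s)`_2 + 3%:R * (esym_poly s)`_3.
Proof.
elim: s => [|x s IHs]; first by rewrite big_nil !coefS_esym_poly_nil; ring.
by rewrite big_cons IHs !coefS_esym_poly coef0_esym_poly; ring.
Qed.

(** The equality case of Cauchy-Schwarz is read off from this sum of squares: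
    for positive entries it vanishes only if each [x] equals [P 2 / P 1]. *)
Lemma cauchy_schwarz_sum s :
  let P k := \sum_(x <- s) x ^+ k in
  P 1 * (P 1 * P 3 - P 2 ^+ 2) = \sum_(x <- s) x * (P 1 * x - P 2) ^+ 2.
Proof.
move=> P; rewrite (eq_bigr (fun x => P 1 ^+ 2 * x ^+ 3
    - 2%:R * P 1 * P 2 * x ^+ 2 + P 2 ^+ 2 * x ^+ 1)) => [|x _]; last first.
  by move: (P 1) (P 2) => u v; ring.
rewrite big_split sumrB /= -!mulr_sumr -/(P 1) -/(P 2) -/(P 3).
by move: (P 1) (P 2) (P 3) => u v w; ring.
Qed.

Lemma sigma_esym_poly n m (lam : 'I_n -> A) :
  sigma m lam = (esym_poly [seq lam i | i <- enum 'I_n])`_m.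
Proof.
have -> : esym_poly [seq lam i | i <- enum 'I_n] = \prod_i (lam i *: 'X + 1).
  by rewrite /esym_poly big_map big_enum; apply: eq_bigr => i _; rewrite addrC.
rewrite sigmaE bigA_distr coef_sum [LHS]big_mkcond; apply: eq_bigr => B _.
have -> : \prod_i (if i \in B then lam i *: 'X else 1)
    = (\prod_(i in B) lam i) *: 'X^#|B| :> {poly A}.
  by rewrite -big_mkcond /= scaler_prodr.
by rewrite coefZ coefXn eq_sym; case: eqP => _; rewrite ?mulr1 ?mulr0.
Qed.

Lemma sigma_const n m x (lam : 'I_n -> A) :
  (forall i, lam i = x) -> sigma m lam = 'C(n, m)%:R * x ^+ m.
Proof.
move=> lamx; rewrite sigmaE (eq_bigr (fun=> x ^+ m)) => [|B /eqP cB].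
  rewrite sumr_const mulr_natl -[X in 'C(X, _)]card_ord -card_draws.
  by rewrite cardsE.
by under eq_bigr do rewrite lamx; rewrite prodr_const cB.
Qed.

End EsymPoly.

Lemma map_esym_poly (A B : comNzRingType) (f : {rmorphism A -> B}) (s : seq A) :
  map_poly f (esym_poly s) = esym_poly (map f s).
Proof.
rewrite /esym_poly rmorph_prod big_map; apply: eq_bigr => x _.
by rewrite rmorphD rmorph1 /= map_polyZ map_polyX.
Qed.

(** Logarithmic derivative of a product of linear factors. *)
Lemma horner_deriv_esym_poly (F : fieldType) (s : seq F) (z : F) :
  (forall x, x \in s -> 1 + x * z != 0) ->
  (esym_poly s)^`().[z] = (esym_poly s).[z] * \sum_(x <- s) x / (1 + x * z).
Proof.
elim: s => [|x s IHs] nz.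
  by rewrite /esym_poly !big_nil -[1]/(1%:P) derivC !hornerE.
have nzx : 1 + x * z != 0 by apply: nz; rewrite mem_head.
have {}IHs := IHs (fun y ys => nz y (mem_behead (s := x :: s) ys)).
rewrite esym_poly_cons derivD derivZ derivM derivX mul1r.
rewrite !(hornerD, hornerZ, hornerM, hornerX) IHs.
by rewrite big_cons; field.
Qed.

Section EsymPolyPos.
Variable R : realDomainType.
Implicit Type s : seq R.

Lemma coef_esym_poly_ge0 s j :
  (forall x, x \in s -> 0 < x) -> 0 <= (esym_poly s)`_j.
Proof.
elim: s j => [|x s IHs] [|j] s_gt0; rewrite ?coef0_esym_poly ?ler01 //.
  by rewrite coefS_esym_poly_nil.
have IH i : 0 <= (esym_poly s)`_i.
  by apply: IHs => y ys; rewrite s_gt0 // in_cons ys orbT.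
by rewrite coefS_esym_poly addr_ge0 // mulr_ge0 // ltW // s_gt0 ?mem_head.
Qed.

Lemma coef1_esym_poly_gt0 s :
  s != [::] -> (forall x, x \in s -> 0 < x) -> 0 < (esym_poly s)`_1.
Proof.
case: s => // x s _ s_gt0; rewrite -newton1 big_cons.
rewrite ltr_pwDl ?s_gt0 ?mem_head // big_seq sumr_ge0 // => y ys.
by rewrite ltW // s_gt0 // in_cons ys orbT.
Qed.

End EsymPolyPos.

(** * The derivative splits again *)

Section DerivSplits.
Variable R : rcfType.
Implicit Type s : seq R.

Lemma Im_sum_log_deriv s (z : R[i]) :
  complex.Im (\sum_(x <- s) x%:C%C / (1 + x%:C%C * z)) =
  - complex.Im z * \sum_(x <- s)
     x ^+ 2 / ((1 + x * complex.Re z) ^+ 2 + (x * complex.Im z) ^+ 2).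
Proof.
elim: s => [|x s IHs]; first by rewrite !big_nil mulr0.
have ImD (a b : R[i]) : complex.Im (a + b) = complex.Im a + complex.Im b.
  by case: a b => [? ?] [].
rewrite !big_cons ImD IHs mulrDr; congr (_ + _).
by case: z {IHs} => u v /=; simpc; ring.
Qed.

(** If [Im z] were nonzero, no factor [1 + x * z] would vanish, and the
    logarithmic derivative at [z] would have a nonzero imaginary part. *)
Lemma root_deriv_esym_poly_real s (z : R[i]) :
  s != [::] -> (forall x, x \in s -> 0 < x) ->
  root (map_poly (real_complex R) (esym_poly s)^`()) z -> complex.Im z = 0.
Proof.
move=> s0 s_gt0; apply: contraTeq => Imz.
have den x : 0 < x -> 0 < (1 + x * complex.Re z) ^+ 2 + (x * complex.Im z) ^+ 2.
  move=> x0; rewrite ltr_wpDl ?sqr_ge0 // lt0r sqr_ge0 andbT sqrf_eq0.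
  by rewrite mulf_neq0 // gt_eqF.
have nz (x : R[i]) : x \in map (real_complex R) s -> 1 + x * z != 0.
  case/mapP => y ys ->; apply: contraTneq (den y (s_gt0 y ys)).
  case: z {Imz den} => u v; simpc => -[-> ->].
  by rewrite expr0n addr0 ltxx.
rewrite /root -deriv_map map_esym_poly horner_deriv_esym_poly // mulf_neq0 //.
  rewrite /esym_poly horner_prod prodf_seq_neq0; apply/allP => x xs /=.
  by rewrite !hornerE nz.
rewrite big_map; apply: contra_neq Imz => /(congr1 (@complex.Im R)).
rewrite Im_sum_log_deriv /= => /eqP; rewrite mulf_eq0 oppr_eq0.
case/orP=> [/eqP //|].
case: s s0 s_gt0 {nz} => // x s _ s_gt0; rewrite big_cons gt_eqF //.
rewrite ltr_pwDl //; first by rewrite divr_gt0 ?den ?exprn_gt0 ?s_gt0 ?mem_head.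
rewrite big_seq sumr_ge0 // => y ys; rewrite divr_ge0 ?sqr_ge0 //.
by rewrite ltW // den // s_gt0 // in_cons ys orbT.
Qed.

(** Over [R[i]] the derivative is a product of linear factors; its roots are
    real, and negative since [p] is positive at every nonnegative point.  A
    factor ['X - z] with [z = - x^-1] is a multiple of [1 + x *: 'X], and the
    resulting factorization descends to [R]. *)
Lemma deriv_esym_poly_splits s :
  s != [::] -> (forall x, x \in s -> 0 < x) ->
  exists (c : R) (t : seq R),
    [/\ c != 0, forall x, x \in t -> 0 < x
      & (esym_poly s)^`() = c *: esym_poly t].
Proof.
move=> s0 s_gt0; set p := (esym_poly s)^`().
pose toC : {rmorphism R -> R[i]} := real_complex R.
have p0 : 0 < p`_0 by rewrite /p coef_deriv coef1_esym_poly_gt0.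
have p_neq0 : p != 0 by apply: contraTneq p0 => ->; rewrite coef0 ltxx.
have p_gt0 x : 0 <= x -> 0 < p.[x].
  move=> x0; rewrite horner_coef.
  have : (0 < size p)%N by rewrite size_poly_gt0.
  case: (size p) => // d _; rewrite big_ord_recl expr0 mulr1 ltr_pwDl //.
  rewrite sumr_ge0 // => i _; rewrite mulr_ge0 ?exprn_ge0 //.
  by rewrite coef_deriv mulrn_wge0 // coef_esym_poly_ge0.
have [rs Dp] := closed_field_poly_normal (map_poly toC p).
have rsP z : z \in rs -> exists2 x, 0 < x & z = toC (- x^-1).
  move=> zrs; have rz : root (map_poly toC p) z.
    by rewrite Dp rootZ ?lead_coef_eq0 ?map_poly_eq0 // root_prod_XsubC.
  have Im0 := root_deriv_esym_poly_real s0 s_gt0 rz.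
  have Dz : z = toC (complex.Re z) by case: z Im0 {zrs rz} => u v /= ->.
  have Re0 : complex.Re z < 0.
    rewrite real_ltNge ?num_real //; apply: contraTN rz => Re_ge0.
    by rewrite Dz rootE horner_map fmorph_eq0 gt_eqF ?p_gt0.
  exists (- (complex.Re z)^-1); first by rewrite oppr_gt0 invr_lt0.
  by rewrite invrN invrK opprK.
have [t t_gt0 Drs] : exists2 t : seq R, (forall x, x \in t -> 0 < x)
    & rs = [seq toC (- x^-1) | x <- t].
  elim: rs rsP {Dp} => [|z rs IHrs] rsP; first by exists [::].
  have [|t t0 ->] := IHrs.
    by move=> y ys; apply: rsP; rewrite in_cons ys orbT.
  have [x x0 ->] := rsP z (mem_head _ _).
  by exists (x :: t) => // y; rewrite in_cons => /predU1P[->|/t0].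
suff [c Dc] : exists c, p = c *: esym_poly t.
  exists c, t; split=> //; apply: contraNneq p_neq0 => c0.
  by rewrite Dc c0 scale0r.
have [c Dc] : exists c, map_poly toC p = c *: esym_poly (map toC t).
  rewrite Dp Drs big_map; elim: t t_gt0 {Drs} => [|x t IHt] t_gt0.
    by exists (lead_coef (map_poly toC p)); rewrite /esym_poly !big_nil.
  have [|c] := IHt; first by move=> y ys; apply: t_gt0; rewrite in_cons ys orbT.
  have Dx : 'X - (toC (- x^-1))%:P = toC x^-1 *: (1 + toC x *: 'X).
    rewrite scalerDr scalerA -rmorphM mulVf ?rmorph1 ?scale1r; last first.
      by rewrite gt_eqF // t_gt0 ?mem_head.
    by rewrite addrC rmorphN polyCN opprK -alg_polyC.
  rewrite /esym_poly map_cons !big_cons => Dc; exists (toC x^-1 * c).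
  by rewrite scalerAr Dc Dx -scalerAl -scalerAr scalerA.
(* Comparing constant coefficients identifies the complex constant [c]
   with the real number [p`_0]. *)
exists p`_0; apply: (map_poly_inj toC); rewrite map_polyZ map_esym_poly [LHS]Dc.
congr (_ *: _); have := congr1 (fun q : {poly R[i]} => q`_0) Dc.
by rewrite coef_map coefZ coef0_esym_poly mulr1.
Qed.

End DerivSplits.

(** * Convexity of the coefficient ratios *)

(** With this weight [j.+1], the constant sequence [nseq n x] gives the affine
    sequence [(n - j) x], and differentiation acts as a shift. *)
Definition coef_ratio (F : fieldType) (p : {poly F}) (j : nat) : F :=
  j.+1%:R * p`_j.+1 / p`_j.

Lemma coef_ratioZ (F : fieldType) c (p : {poly F}) j :
  c != 0 -> coef_ratio (c *: p) j = coef_ratio p j.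
Proof.
by move=> c0; rewrite /coef_ratio !coefZ mulrCA -mulf_div divff // mul1r.
Qed.

Lemma coef_ratio_deriv (F : numFieldType) (p : {poly F}) j :
  coef_ratio p^`() j = coef_ratio p j.+1.
Proof.
rewrite /coef_ratio !coef_deriv -(mulr_natl p`_j.+2) -(mulr_natl p`_j.+1).
by rewrite -mulf_div divff ?mul1r // pnatr_eq0.
Qed.

Lemma coef_ratio_convex0_sum (F : fieldType) (s : seq F) :
    (esym_poly s)`_1 != 0 -> (esym_poly s)`_2 != 0 ->
  let p := esym_poly s in
  p`_1 ^+ 2 * p`_2 * (coef_ratio p 0 - 2%:R * coef_ratio p 1 + coef_ratio p 2)
  = \sum_(x <- s) x * (p`_1 * x - \sum_(y <- s) y ^+ 2) ^+ 2.
Proof.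
move=> a1 a2 p; have P1 : \sum_(x <- s) x ^+ 1 = p`_1 by rewrite /p -newton1.
have := cauchy_schwarz_sum s; rewrite /= P1 => <-; rewrite newton2 newton3.
rewrite /coef_ratio coef0_esym_poly -/p.
by field; rewrite a2 a1 oner_neq0.
Qed.

Section Convexity.
Variable R : rcfType.
Implicit Type s : seq R.

(** The bound holds even past the degree of the polynomial, because ratios
    with denominator [0] are [0]; so no condition on [j] has to be carried
    through the successive derivatives. *)
Lemma coef_ratio_convex s j : (forall x, x \in s -> 0 < x) ->
  let r := coef_ratio (esym_poly s) in 0 <= r j - 2%:R * r j.+1 + r j.+2.
Proof.
elim: j s => [|j IHj] s s_gt0 /=; have [->|s0] := eqVneq s [::].
- by rewrite /coef_ratio !coefS_esym_poly_nil !(mulr0, mul0r) subrr addr0.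
- have a1 := coef1_esym_poly_gt0 s0 s_gt0.
  have [a2|a2] := eqVneq (esym_poly s)`_2 0.
    rewrite /coef_ratio a2 invr0 !(mulr0, mul0r) subr0 addr0.
    by rewrite coef0_esym_poly invr1 mulr1 mul1r ltW.
  have a12 : 0 < (esym_poly s)`_1 ^+ 2 * (esym_poly s)`_2.
    by rewrite mulr_gt0 ?exprn_gt0 // lt0r a2 coef_esym_poly_ge0.
  rewrite -(pmulr_rge0 _ a12) (coef_ratio_convex0_sum (lt0r_neq0 a1) a2).
  rewrite big_seq sumr_ge0 // => x xs; rewrite mulr_ge0 ?sqr_ge0 //.
  by rewrite ltW ?s_gt0.
- by rewrite /coef_ratio !coefS_esym_poly_nil !(mulr0, mul0r) subrr addr0.
have [c [t [c0 t_gt0 Ds]]] := deriv_esym_poly_splits s0 s_gt0.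
have shift := coef_ratio_deriv (esym_poly s).
by rewrite -!shift Ds !coef_ratioZ //; apply: IHj.
Qed.

Lemma coef_ratio_convex_eq0 s : (forall x, x \in s -> 0 < x) ->
  let r := coef_ratio (esym_poly s) in r 0 - 2%:R * r 1 + r 2 = 0 ->
  {in s &, forall x y, x = y}.
Proof.
move=> s_gt0 r r0; have [->//|s0] := eqVneq s [::].
have a1 := coef1_esym_poly_gt0 s0 s_gt0.
have [a2|a2] := eqVneq (esym_poly s)`_2 0.
  (* A single entry: the second difference is [r 0 > 0]. *)
  move: r0; rewrite /r /coef_ratio a2 invr0 !(mulr0, mul0r) subr0 addr0.
  by rewrite coef0_esym_poly invr1 mulr1 mul1r => /eqP; rewrite gt_eqF.
have := coef_ratio_convex0_sum (lt0r_neq0 a1) a2.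
rewrite /= -/(r _) r0 mulr0; set P2 := \sum_(y <- s) y ^+ 2.
move=> /esym/eqP; rewrite big_seq psumr_eq0 => [/allP sum0|x xs]; last first.
  by rewrite mulr_ge0 ?sqr_ge0 // ltW ?s_gt0.
have P2E x : x \in s -> (esym_poly s)`_1 * x = P2.
  move=> xs; have := sum0 x xs; rewrite xs mulf_eq0 (gt_eqF (s_gt0 _ xs)) /=.
  by rewrite sqrf_eq0 subr_eq0 => /eqP.
move=> x y xs ys; apply: (mulfI (lt0r_neq0 a1)).
by rewrite !P2E.
Qed.

(** Passing from [m] to [m.+1] adds [m.+2%:R] times the second difference of
    [r] at [m.+1]. *)
Lemma coef_ratio_gap_ge s m : (forall x, x \in s -> 0 < x) ->
  let r := coef_ratio (esym_poly s) in
  r 0 - 2%:R * r 1 + r 2 <= r 0 - m.+2%:R * r m.+1 + m.+1%:R * r m.+2.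
Proof.
move=> s_gt0 /=; set r := coef_ratio _.
elim: m => [|m IHm]; first by rewrite mul1r.
apply: (le_trans IHm); rewrite -subr_ge0.
have := mulr_ge0 (ler0n _ m.+2) (coef_ratio_convex m.+1 s_gt0).
by rewrite -/r; congr (0 <= _); ring.
Qed.

End Convexity.

Theorem lemma2p1 (R : realType) (n k : nat) (lam : 'I_n -> R)
    (hn : (2 <= n)%N) (hk : (2 <= k <= n)%N) (hlam : forall i, 0 < lam i) :
  let E := 1 / (k%:R * (k%:R - 1)) * sigma 1 lam
           - (k%:R * sigma k lam) / ((k%:R - 1) * sigma k.-1 lam)
           + (k.+1%:R * sigma k.+1 lam) / (k%:R * sigma k lam) in
  0 <= E /\ (E = 0 <-> forall i j : 'I_n, lam i = lam j).
Proof.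
case: k hk => [|[|m]] //= hm.
set s := [seq lam i | i <- enum 'I_n].
pose r := coef_ratio (esym_poly s).
have s_gt0 x : x \in s -> 0 < x by case/mapP => i _ ->.
set E := (X in 0 <= X).
change (0 <= E /\ (E = 0 <-> forall i j, lam i = lam j)).
have DE : m.+2%:R * m.+1%:R * E
        = r 0 - m.+2%:R * r m.+1 + m.+1%:R * r m.+2.
  rewrite /E /r /coef_ratio -!sigma_esym_poly sigma0.
  have -> : m.+2%:R - 1 = m.+1%:R :> R by rewrite -(natr1 m.+1) addrK.
  (* With the inverses as indeterminates, the identity is polynomial. *)
  rewrite !invfM divr1; move: (sigma _ _)^-1 (sigma _ _)^-1 => u v.
  by field; rewrite -(natrD _ 2) nat1r !pnatr_eq0.
have Egap := coef_ratio_gap_ge m s_gt0.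
have m21 : 0 < m.+2%:R * m.+1%:R :> R by rewrite mulr_gt0 ?ltr0n.
have conv0 : 0 <= r 0 - 2%:R * r 1 + r 2 := coef_ratio_convex 0 s_gt0.
have E0 : 0 <= E by rewrite -(pmulr_rge0 _ m21) DE (le_trans conv0).
split=> //; split=> [E_eq0 i j | lam_eq].
  apply: (coef_ratio_convex_eq0 s_gt0); rewrite ?map_f ?mem_enum //.
  apply/eqP; rewrite eq_le conv0 andbT (le_trans Egap) //.
  by rewrite -/r -DE E_eq0 mulr0.
have n_gt0 : (0 < n)%N by apply: ltnW.
have sig j := sigma_const j (fun i => lam_eq i (Ordinal n_gt0)).
set x := lam _ in sig.
have x0 : x != 0 by rewrite gt_eqF ?hlam.
have ratio j : (j <= n)%N -> r j = (n%:R - j%:R) * x.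
  move=> jn; rewrite /r /coef_ratio -!sigma_esym_poly !sig.
  rewrite mulrA -natrM mul_bin_left natrM natrB // exprS.
  by field; rewrite expf_neq0 // pnatr_eq0 -lt0n bin_gt0.
apply: (mulfI (lt0r_neq0 m21)); rewrite mulr0 DE !ratio //; last exact: ltnW.
by ring.
Qed.
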